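(* Let $n \ge 1$ and let $T_R=([n], E_{red})$ and $T_B=([n], E_{blue})$ be two tournaments (a red one and a blue one) on the same vertex set $[n]$. Then there is a vertex $\nu \in [n]$ such that every $j\in[n]$ is reachable from $\nu$ by a rainbow directed path of length at most $2$.
   Context: $[n]=\{1,\dots,n\}$. A tournament $T=([n],E)$ is a directed graph without loops on vertex set $[n]$ such that for every two distinct vertices $i,j$ exactly one of $(i,j)$, $(j,i)$ belongs to $E$. The edges in $E_{red}$ are colored red and the edges in $E_{blue}$ are colored blue; the two tournaments are arbitrary, and a pair $(i,j)$ may be both a red edge and a blue edge. A directed path using edges of $T_R$ and $T_B$ is rainbow if its edges have pairwise different colors. Thus $j$ is reachable from $\nu$ by a rainbow directed path of length at most $2$ if and only if $j=\nu$ (path of length $0$), or $(\nu,j)\in E_{red}$, or $(\nu,j)\in E_{blue}$, or there is $k$ with $(\nu,k)\in E_{red}$ and $(k,j)\in E_{blue}$, or there is $k$ with $(\nu,k)\in E_{blue}$ and $(k,j)\in E_{red}$. *)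

(* Defs.v *)
From HB Require Import structures.
From mathcomp Require Import all_boot.

Set Implicit Arguments.
Unset Strict Implicit.
Unset Printing Implicit Defensive.

Definition is_tournament (n : nat) (e : rel 'I_n) : Prop :=
  irreflexive e /\ (forall i j : 'I_n, i != j -> e i j (+) e j i).

Inductive color := Red | Blue.

Definition bool_of_color (c : color) : bool := if c is Red then true else false.
Definition color_of_bool (b : bool) : color := if b then Red else Blue.
Lemma bool_of_colorK : cancel bool_of_color color_of_bool.
Proof. by case. Qed.
HB.instance Definition _ := Equality.copy color (can_type bool_of_colorK).

Definition colored_edge (n : nat) (red blue : rel 'I_n) (c : color) : rel 'I_n :=
  if c is Red then red else blue.

(* A walk from x is the sequence of its steps, a step (c, y) being an edge of
   color c with head y.  The color is part of the step because the same ordered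
   pair may be both a red edge and a blue edge. *)
Fixpoint directed_walk (n : nat) (red blue : rel 'I_n) (x : 'I_n)
    (p : seq (color * 'I_n)) : bool :=
  if p is (c, y) :: p' then
    colored_edge red blue c x y && directed_walk red blue y p'
  else true.

Definition directed_path (n : nat) (red blue : rel 'I_n) (x : 'I_n)
    (p : seq (color * 'I_n)) : bool :=
  directed_walk red blue x p && uniq (x :: unzip2 p).

Definition rainbow (n : nat) (p : seq (color * 'I_n)) : bool := uniq (unzip1 p).

Definition rainbow_reachable (n : nat) (red blue : rel 'I_n) (l : nat)
    (x y : 'I_n) : Prop :=
  exists p : seq (color * 'I_n),
    [/\ directed_path red blue x p, rainbow p, size p <= l
      & last x (unzip2 p) = y].

Lemma rainbow_reachable2P (n : nat) (red blue : rel 'I_n) (x y : 'I_n) :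
  is_tournament red -> is_tournament blue ->
  rainbow_reachable red blue 2 x y <->
  [\/ y = x, red x y, blue x y |
      (exists k, red x k /\ blue k y) \/ (exists k, blue x k /\ red k y)].
Proof.
move=> [rI _] [bI _]; split.
  case=> [[|[c1 z1] [|[c2 z2] [|? ?]]]] [] //.
  - by move=> _ _ _ /= ->; constructor 1.
  - rewrite /directed_path /= andbT => /andP[e _] _ _ <-.
    by case: c1 e => /= e; [constructor 2 | constructor 3].
  rewrite /directed_path /rainbow /= !andbT.
  case/andP=> /andP[e1 e2] _ + _ <-; rewrite inE => c12.
  constructor 4; case: c1 c2 e1 e2 c12 => [] [] //= e1 e2 _;
    by [left; exists z1 | right; exists z1].
have neq e (u v : 'I_n) : irreflexive e -> e u v -> u != v.
  by move=> eI; apply: contraTneq => ->; rewrite eI.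
have [-> _|yx] := eqVneq y x; first by exists [::].
have xy : x != y by rewrite eq_sym.
case=> [/eqP|e|e|[|] [k [e1 e2]]]; first by rewrite (negPf yx).
- by exists [:: (Red, y)]; split; rewrite // /directed_path /= e inE xy.
- by exists [:: (Blue, y)]; split; rewrite // /directed_path /= e inE xy.
- exists [:: (Red, k); (Blue, y)]; split; rewrite // /directed_path /= e1 e2.
  by rewrite !inE negb_or xy (neq _ _ _ rI e1) (neq _ _ _ bI e2).
- exists [:: (Blue, k); (Red, y)]; split; rewrite // /directed_path /= e1 e2.
  by rewrite !inE negb_or xy (neq _ _ _ bI e1) (neq _ _ _ rI e2).
Qed.

(* Main.v *)
Require Import Defs.
From mathcomp Require Import all_boot.

(** A vertex v maximizing the sum of its red and blue outdegrees works.  If j is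
    not reachable from v, then j beats v in both colors, every red out-neighbour
    of v is a blue out-neighbour of j, and vice versa; since v itself is an
    out-neighbour of j, the outdegree sum of j exceeds that of v. *)

Lemma tournament_total n (e : rel 'I_n) i j :
  is_tournament e -> i != j -> ~~ e i j -> e j i.
Proof. by case=> _ et /et + /negPf eij; rewrite eij. Qed.

(** Used twice, with the two colors as [e], [f] in either order. The [e]-out-neighbours of [v] are
    [f]-out-neighbours of [j]; the inclusion is proper because [v] lies only in the second set. *)
Lemma outdegree_lt n (e f : rel 'I_n) v j :
    irreflexive e -> is_tournament f -> j != v -> ~~ e v j -> ~~ f v j ->
    (forall k, e v k -> ~~ f k j) ->
  #|e v| < #|f j|.
Proof.
move=> eI ft jv evj fvj evf; apply/proper_card/properP; split.
  apply/subsetP=> k evk; have kj : k != j.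
    by apply: contraNneq evj => <-.
  exact: tournament_total (evf k evk).
exists v; last by rewrite -topredE /= eI.
by apply: tournament_total (ft) _ fvj; rewrite eq_sym.
Qed.

Theorem corollary3 (n : nat) (hn : 1 <= n) (red blue : rel 'I_n)
    (hred : is_tournament red) (hblue : is_tournament blue) :
  exists v : 'I_n, forall j : 'I_n, rainbow_reachable red blue 2 v j.
Proof.
pose deg v := #|red v| + #|blue v|.
have [v _ vmax] := @arg_maxnP _ (Ordinal hn) xpredT deg isT.
exists v => j; apply/(rainbow_reachable2P _ _ hred hblue).
have [->|jv] := eqVneq j v; first by constructor 1.
have [rvj|rvj] := boolP (red v j); first by constructor 2.
have [bvj|bvj] := boolP (blue v j); first by constructor 3.
have [/existsP[k /andP[? ?]]|/existsPn rb] :=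
  boolP [exists k, red v k && blue k j].
  by constructor 4; left; exists k.
have [/existsP[k /andP[? ?]]|/existsPn br] :=
  boolP [exists k, blue v k && red k j].
  by constructor 4; right; exists k.
have lt_rb : #|red v| < #|blue j|.
  apply: outdegree_lt (hblue) jv rvj bvj _; first by case: hred.
  by move=> k rvk; move: (rb k); rewrite rvk.
have lt_br : #|blue v| < #|red j|.
  apply: outdegree_lt (hred) jv bvj rvj _; first by case: hblue.
  by move=> k bvk; move: (br k); rewrite bvk.
(* Both bounds cross colors, so the summands of [deg j] are swapped to compare with those of [deg v]
   one by one; this gives [deg v < deg j], against maximality. *)
have := vmax j isT; rewrite /= leqNgt /deg [X in _ < X]addnC.
by rewrite -addnS leq_add // ltnW.
Qed.
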